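(* Let $\mathbf{s}$ be a degree sequence of size $s\ge2$, and let $W$ be the depth-first walk of a random tree $\Theta$ with law $\mathbb P_{\mathbf{s}}$. Let $V$ be a uniform random variable on $\{2,\dots,s\}$ independent of $\Theta$, and let $h$ be a positive integer. When the vertex of $\Theta$ with depth-first label $V$ has height greater than $h$, let $U$ be its unique ancestor at distance $h$ from $V$, and define $\tilde W=\Psi_{U,V}(W)$. When the height of $V$ is at most $h$, set $\tilde W=W$. Then $(\tilde W,V)$ and $(W,V)$ have the same law.
   Context: A rooted plane tree is a finite set $\tau$ of finite words over $\{1,2,\dots\}$ containing the empty word (root), closed under removing the last letter, such that each $u\in\tau$ has a number $\chi(u)\ge0$ of children with $uj\in\tau$ iff $1\le j\le\chi(u)$. The height of $u$ is its length. A degree sequence is a sequence $\mathbf{s}=(N_i,i\ge0)$ of non-negative integers with $\sum_iN_i=1+\sum_iiN_i<\infty$; its size is $s=\sum_iN_i$; $\mathbb P_{\mathbf{s}}$ is the uniform law on rooted plane trees with exactly $N_i$ vertices having $i$ children for every $i$. Depth-first order is the lexicographic order; vertices are labelled $1,\dots,|\tau|$ accordingly, and the depth-first walk is started at $1$ with $i$-th increment $\chi(i)-1$, where $\chi(i)$ is the number of children of vertex $i$. It determines the tree. 213 transformation: let $\tau$ be a plane tree labelled in depth-first order, $v\in\{2,\dots,|\tau|\}$ a vertex and $u$ a strict ancestor of $v$. Cut $\tau$ at $u$ and $v$, obtaining three trees: $\tau(1,u)$, containing the original root and in which $u$ is a leaf (all strict descendants of $u$ removed); $\tau(u,v)$,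 with root $u$, consisting of $u$ and its descendants, in which $v$ is a leaf (all strict descendants of $v$ removed); and $\tau(v)$, consisting of $v$ and its descendants. $\Psi_{u,v}(\tau)$ is the plane tree obtained by grafting the root of $\tau(v)$ at the leaf $u$ of $\tau(1,u)$, and then grafting the root of the resulting tree at the leaf $v$ of $\tau(u,v)$ (grafting identifies the root with the leaf, keeping planar order). If $w$ is the depth-first walk of $\tau$, $\Psi_{u,v}(w)$ denotes the depth-first walk of $\Psi_{u,v}(\tau)$. *)

(* Defs.v *)
From HB Require Import structures.
From mathcomp Require Import all_boot all_order all_algebra finmap.
From mathcomp Require Import all_classical all_reals all_analysis.
From mathcomp Require Import zify.

Set Implicit Arguments.
Unset Strict Implicit.
Unset Printing Implicit Defensive.

Import Order.TTheory GRing.Theory Num.Theory.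

Local Open Scope fset_scope.
Local Open Scope nat_scope.

Notation word := (seq nat).

Definition is_plane_tree (t : {fset word}) : Prop :=
  [/\ [::] \in t,
      forall u j, rcons u j \in t -> u \in t &
      forall u, u \in t ->
        exists c, forall j, (rcons u j \in t) = (1 <= j <= c)].

Record plane_tree := PlaneTree
  { vertices :> {fset word}; _ : `[< is_plane_tree vertices >] }.

HB.instance Definition _ := [isSub for vertices].
HB.instance Definition _ := [Countable of plane_tree by <:].

Lemma plane_treeP (t : plane_tree) : is_plane_tree t.
Proof. by apply/asboolP; case: t. Qed.

Lemma is_plane_tree1 : is_plane_tree [fset [::]].
Proof.
split=> [|u j|u]; rewrite ?inE //; first by case: u.
move=> /eqP->; exists 0 => -[|[|j]] //=; rewrite ?inE //.
Qed.

HB.instance Definition _ :=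
  isPointed.Build plane_tree (PlaneTree (asboolT is_plane_tree1)).

HB.instance Definition _ := @isMeasurable.Build default_measure_display
  plane_tree discrete_measurable discrete_measurable0
  discrete_measurableC discrete_measurableU.

Definition nchild (t : {fset word}) (u : word) : nat :=
  #|` [fset w in t | prefix u w && (size w == (size u).+1)] |.

Lemma nchild_unique (t : {fset word}) u c :
  (forall j, (rcons u j \in t) = (1 <= j <= c)) -> nchild t u = c.
Proof.
move=> tc; rewrite /nchild.
suff -> : [fset w in t | prefix u w && (size w == (size u).+1)]
  = [fset w in map (rcons u) (iota 1 c)].
  rewrite card_fseq undup_id ?size_map ?size_iota //.
  by rewrite map_inj_uniq ?iota_uniq //; exact: rcons_injr.
apply/fsetP => w; rewrite !inE /=; apply/idP/idP.
  move=> /and3P[wt /prefixP[r wr]]; rewrite {}wr in wt *.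
  rewrite size_cat -addn1 eqn_add2l.
  case: r wt => [|j [|? ?]] // wt _; rewrite cats1 in wt *.
  by apply: map_f; rewrite mem_iota add1n ltnS -tc.
move=> /mapP[j]; rewrite mem_iota add1n ltnS -tc => jt ->.
by rewrite jt prefix_rcons size_rcons eqxx.
Qed.

Lemma nchildP (t : plane_tree) u j :
  u \in (t : {fset word}) ->
  (rcons u j \in (t : {fset word})) = (1 <= j <= nchild t u).
Proof.
move=> ut; have [_ _ /(_ _ ut)[c tc]] := plane_treeP t.
by rewrite (nchild_unique tc).
Qed.

(* Depth-first order is the lexicographic order on words. *)
Definition dfs (t : {fset word}) : seq word :=
  sort (fun u v : word => ((u : seqlexi nat) <= (v : seqlexi nat))%O)
       (enum_fset t).

(* Labels start at 1. *)
Definition vertex (t : {fset word}) (k : nat) : word := nth [::] (dfs t) k.-1.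

Definition dfwalk (t : {fset word}) : seq int :=
  (1 :: scanl (fun x c => x + (c%:Z - 1)) 1 [seq nchild t u | u <- dfs t])%R.

(* t with the strict descendants of u removed *)
Definition prune (t : {fset word}) (u : word) : {fset word} :=
  [fset w in t | ~~ prefix u w || (w == u)].

(* u and its descendants in t, re-rooted at u *)
Definition subtree (t : {fset word}) (u : word) : {fset word} :=
  [fset drop (size u) w | w in t & prefix u w].

(* the root of t' is identified with the leaf x of t *)
Definition graft (t : {fset word}) (x : word) (t' : {fset word})
    : {fset word} :=
  t `|` [fset x ++ w | w in t'].

(* In tau(u,v), re-rooted at u, the leaf v is the word [drop (size u) v]. *)
Definition Psi (t : {fset word}) (u v : word) : {fset word} :=
  graft (subtree (prune t v) u) (drop (size u) v)
        (graft (prune t u) u (subtree t v)).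

Lemma mem_subtree (t : {fset word}) u w : (w \in subtree t u) = (u ++ w \in t).
Proof.
apply/imfsetP/idP => /= [[x /andP[xt /prefixP[r xr]] ->]|uwt].
  by rewrite xr drop_size_cat // -xr.
by exists (u ++ w); rewrite ?inE ?uwt ?prefix_prefix ?drop_size_cat.
Qed.

Lemma mem_prune (t : {fset word}) u w :
  (w \in prune t u) = (w \in t) && (~~ prefix u w || (w == u)).
Proof. by rewrite !inE. Qed.

Lemma prune_leaf (t : {fset word}) u j : rcons u j \notin prune t u.
Proof.
rewrite mem_prune prefix_rcons /=; apply/negP => /andP[_ /eqP].
by move/(congr1 size); rewrite size_rcons; lia.
Qed.

Lemma prune_plane_tree (t : {fset word}) u :
  is_plane_tree t -> is_plane_tree (prune t u).
Proof.
move=> [t0 tp tc]; split.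
- by rewrite mem_prune t0 prefixs0 /= eq_sym; case: eqP.
- move=> w j; rewrite !mem_prune => /andP[wt /orP H]; rewrite (tp _ _ wt) /=.
  have [/prefixP[r wr]|//] := boolP (prefix u w).
  case: H => [|/eqP ujw].
    by rewrite wr -cats1 -catA prefix_prefix.
  by move: (congr1 size ujw); rewrite wr size_rcons size_cat; lia.
move=> w; rewrite mem_prune => /andP[wt H].
have [/eqP ->|wu] := boolP (w == u).
  exists 0 => j; rewrite (negbTE (prune_leaf _ _ _)).
  by case: j.
move: H; rewrite (negbTE wu) orbF => uw.
have [c tcj] := tc _ wt; exists c => j; rewrite mem_prune -tcj.
have [_|//] := boolP (rcons w j \in t) => /=.
have [/prefixP[r]|//] := boolP (prefix u _).
case/lastP: r => [|r k]; first by rewrite cats0 => ->; rewrite eqxx.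
rewrite -rcons_cat => /rcons_inj[wr _].
by move: uw; rewrite wr prefix_prefix.
Qed.

Lemma subtree_plane_tree (t : {fset word}) u :
  u \in t -> is_plane_tree t -> is_plane_tree (subtree t u).
Proof.
move=> ut [t0 tp tc]; split.
- by rewrite mem_subtree cats0.
- by move=> w j; rewrite !mem_subtree -rcons_cat; exact: tp.
move=> w; rewrite mem_subtree => /tc[c tcj]; exists c => j.
by rewrite mem_subtree -rcons_cat.
Qed.

Lemma graft_plane_tree (t t' : {fset word}) x :
  x \in t -> (forall j, rcons x j \notin t) ->
  is_plane_tree t -> is_plane_tree t' -> is_plane_tree (graft t x t').
Proof.
move=> xt xl [t0 tp tc] [t'0 t'p t'c].
have gE w : (w \in graft t x t') = (w \in t) || (w \in [fset x ++ r | r in t']).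
  by rewrite !inE.
have gx r : (x ++ r \in [fset x ++ r | r in t']) = (r \in t').
  apply/imfsetP/idP => [[r' /= r't] |rt]; last by exists r.
  by move=> /eqP; rewrite eqseq_cat // eqxx /= => /eqP->.
have tdesc r : x ++ r \in t -> r = [::].
  case: r => // j r; elim/last_ind: r => [|r k IH].
    by rewrite cats1 (negbTE (xl j)).
  by rewrite -rcons_cons -rcons_cat => /tp /IH.
split.
- by rewrite gE t0.
- move=> w j; rewrite !gE => /orP[/tp->//|/imfsetP[/= r rt]].
  case/lastP: r rt => [|r k] rt.
    by rewrite cats0 => xE; rewrite (tp w j) // xE.
  by rewrite -rcons_cat => /rcons_inj[-> _]; rewrite gx (t'p _ _ rt) orbT.
move=> w; rewrite gE.
have [/prefixP[r ->{w}] wg|nxw] := boolP (prefix x w).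
  have rt' : r \in t'.
    by case/orP: wg => [/tdesc->//|]; rewrite gx.
  have [c cE] := t'c _ rt'; exists c => j.
  rewrite gE rcons_cat gx cE; case: (boolP (_ \in t)) => // /tdesc.
  by case: r {wg rt' cE}.
case: (boolP (w \in t)) => [wt _|_ /= /imfsetP[/= r _ wr]]; last first.
  by rewrite wr prefix_prefix in nxw.
have [c cE] := tc _ wt; exists c => j; rewrite gE cE.
case: (_ <= _ <= _) (cE j) => //= ct; apply/negP => /imfsetP[/= r _].
case/lastP: r => [|r k].
  by rewrite cats0 => xE; rewrite xE xt in ct.
rewrite -rcons_cat => /rcons_inj[wr _].
by rewrite wr prefix_prefix in nxw.
Qed.

Lemma Psi_plane_tree (t : {fset word}) u v :
  is_plane_tree t -> u \in t -> v \in t -> prefix u v -> u != v ->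
  is_plane_tree (Psi t u v).
Proof.
move=> tt ut vt /prefixP[r vE] uv.
have uP : u \in prune t v.
  rewrite mem_prune ut /=; apply/orP; left; apply/negP => /prefixP[r' uE].
  move/eqP: uv; apply; have := congr1 size uE.
  rewrite vE !size_cat; case: r vE => [|x r] _ /=; last by lia.
  by rewrite cats0.
apply: graft_plane_tree.
- by rewrite mem_subtree vE drop_size_cat // mem_prune -vE vt eqxx orbT.
- move=> j; rewrite mem_subtree vE drop_size_cat // -rcons_cat -vE.
  exact: prune_leaf.
- by apply: subtree_plane_tree => //; exact: prune_plane_tree.
apply: graft_plane_tree.
- by rewrite mem_prune ut eqxx orbT.
- by move=> j; exact: prune_leaf.
- exact: prune_plane_tree.
exact: subtree_plane_tree.
Qed.

(* The walk of Psi_{u,v}(t), where v has label k and u, its ancestor at distance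
   h, is v deprived of its last h letters; the walk of t if height(v) <= h. *)
Definition shuffled_walk (h : nat) (t : {fset word}) (k : nat) : seq int :=
  let v := vertex t k in
  if h < size v then dfwalk (Psi t (take (size v - h) v) v) else dfwalk t.

Local Open Scope classical_set_scope.

Definition degree_sequence (N : nat -> nat) : Prop :=
  finite_set [set i | N i != 0] /\
  \big[addn/0]_(i \in [set: nat]) N i
    = 1 + \big[addn/0]_(i \in [set: nat]) (i * N i).

Definition degree_size (N : nat -> nat) : nat :=
  \big[addn/0]_(i \in [set: nat]) N i.

Definition trees_with (N : nat -> nat) : set plane_tree :=
  [set t | forall i, #|` [fset u in vertices t | nchild t u == i] |%fset = N i].

(* The uniform law on a finite nonempty set E. *)
Definition uniform_on (R : realType) (T : choiceType) (E A : set T) : \bar R :=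
  ((#|` fset_set (E `&` A) |%fset)%:R / (#|` fset_set E |%fset)%:R)%:E%R.

Definition independent2 d d1 d2 (Omega : measurableType d)
    (T1 : measurableType d1) (T2 : measurableType d2) (R : realType)
    (P : probability Omega R) (X : {RV P >-> T1}) (Y : {RV P >-> T2}) : Prop :=
  forall A B, measurable A -> measurable B ->
    (P (X @^-1` A `&` Y @^-1` B) = P (X @^-1` A) * P (Y @^-1` B))%E.

(* Main.v *)
(** Write u and v = u r for the two vertices. On words, Psi_{u,v} sends u r y to
    r u y, any other u y to y, and any remaining word w to r w. This relabelling
    of the vertices is undone by the one attached to r and u, preserves numbers
    of children, and maps the vertices preceding u r in lexicographic order to
    those preceding r u. Hence the image of v has the same label and the same
    height as v, its ancestor at distance h is u read off from r u, and for each
    fixed label k the transformation is an injection of the finite set of trees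
    with the given degrees into itself, thus preserves the uniform law.
    Conditioning on V = k gives the result. *)

Require Import Defs.
From HB Require Import structures.
From mathcomp Require Import all_boot all_order all_algebra finmap.
From mathcomp Require Import all_classical all_reals all_analysis.
From mathcomp Require Import zify.

Set Implicit Arguments.
Unset Strict Implicit.
Unset Printing Implicit Defensive.

Import Order.TTheory.

Local Open Scope classical_set_scope.
Local Open Scope nat_scope.

(** * The relabelling of words *)

(** Defined on all words, without reference to a tree, so that it is a bijection of words and trees
    can be compared through membership alone. *)
Definition swap (u r w : word) : word :=
  if prefix (u ++ r) w then r ++ u ++ drop (size (u ++ r)) w
  else if prefix u w then drop (size u) w else r ++ w.

Variant swap_spec (u r : word) : word -> word -> Prop :=
| SwapDesc y : swap_spec u r (u ++ r ++ y) (r ++ u ++ y)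
| SwapMid y of ~~ prefix r y : swap_spec u r (u ++ y) y
| SwapOut w of ~~ prefix u w : swap_spec u r w (r ++ w).

Lemma prefix_cat2l (s x y : word) : prefix (s ++ x) (s ++ y) = prefix x y.
Proof. by rewrite prefix_catr // eqxx. Qed.

Lemma swapP u r w : swap_spec u r w (swap u r w).
Proof.
rewrite /swap; case: ifP => [/prefixP[y ->]|/negbT uxw].
  by rewrite drop_size_cat // -catA; constructor.
case: ifP => [/prefixP[y wE]|/negbT]; last by constructor.
rewrite wE drop_size_cat //; constructor.
by rewrite wE prefix_cat2l in uxw.
Qed.

Lemma swap_desc u r y : swap u r (u ++ r ++ y) = r ++ u ++ y.
Proof. by rewrite /swap catA prefix_prefix drop_size_cat. Qed.

Lemma swap_mid u r y : ~~ prefix r y -> swap u r (u ++ y) = y.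
Proof.
by move=> /negbTE ry; rewrite /swap prefix_cat2l ry prefix_prefix drop_size_cat.
Qed.

Lemma swap_out u r w : ~~ prefix u w -> swap u r w = r ++ w.
Proof.
move=> uw; rewrite /swap (negbTE uw); case: ifP => // /prefixP[y wE].
by rewrite wE -catA prefix_prefix in uw.
Qed.

(** Words extending [u ++ r] go to words extending [r ++ u]; the two other cases trade places when
    [u] and [r] are exchanged. *)
Lemma swapK u r : cancel (swap u r) (swap r u).
Proof.
move=> w; case: (swapP u r w) => [y|y ry|{}w uw].
- by rewrite swap_desc.
- by rewrite swap_out.
- by rewrite swap_mid.
Qed.

(** * Lexicographic order and the relabelling *)

Definition lexlt (x y : word) := ((x : seqlexi nat) < (y : seqlexi nat))%O.
Arguments lexlt : simpl never.

Lemma lexlt_cons a x b y :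
  lexlt (a :: x) (b :: y) = (a < b)%N || (a == b) && lexlt x y.
Proof.
rewrite /lexlt ltxi_cons !leEnat.
by case: ltngtP => //= ->.
Qed.

Lemma lexlt_catl s x y : lexlt (s ++ x) (s ++ y) = lexlt x y.
Proof. by elim: s => // a s IH; rewrite !cat_cons lexlt_cons ltnn eqxx. Qed.

(** A word that does not extend [r] is a proper prefix of [r] or differs from it at some letter, so
    the comparison is settled within [r]. *)
Lemma lexlt_catr r x y : ~~ prefix r x -> lexlt x (r ++ y) = lexlt x r.
Proof.
elim: r x => [|a r IH] [|b x] //=; rewrite !lexlt_cons [b == a]eq_sym.
by case: (a == b) => //= /IH->.
Qed.

Lemma lexlt_prefix x y : lexlt (x ++ y) x = false.
Proof.
elim: x => [|a x IH]; first exact: ltxis0.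
by rewrite cat_cons lexlt_cons ltnn eqxx.
Qed.

Lemma lexlt_swap u r w : lexlt (swap u r w) (r ++ u) = lexlt w (u ++ r).
Proof.
case: (swapP u r w) => [y|y ry|{}w uw].
- by rewrite !catA !lexlt_prefix.
- by rewrite lexlt_catr // lexlt_catl.
- by rewrite lexlt_catl [RHS]lexlt_catr.
Qed.

(** * The transformed tree as the image of the relabelling *)

Local Open Scope fset_scope.

Lemma mem_graft (t t' : {fset word}) x w :
  (w \in graft t x t') = (w \in t) || prefix x w && (drop (size x) w \in t').
Proof.
rewrite in_fsetU; congr (_ || _); apply/imfsetP/andP => /= [[y yt ->]|[]].
  by rewrite prefix_prefix drop_size_cat.
by move=> /prefixP[y ->]; rewrite drop_size_cat // => yt; exists y.
Qed.

Lemma plane_tree_prefix (t : {fset word}) x y :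
  is_plane_tree t -> x ++ y \in t -> x \in t.
Proof.
move=> [_ tp _]; elim/last_ind: y => [|y j IH]; first by rewrite cats0.
by rewrite -rcons_cat => /tp.
Qed.

Lemma cat_eq_self (x y : word) : (x ++ y == x) = (y == [::]).
Proof. by rewrite -{2}[x]cats0 eqseq_cat // eqxx. Qed.

Section Psi.
Variables (t : {fset word}) (u r : word).
Hypotheses (tt : is_plane_tree t) (vt : u ++ r \in t).
Hypothesis (u0 : u != [::]).

(** The three pieces of the graft match the three cases of the inverse relabelling, except that the
    glued points [r] and [r ++ u] each lie in two pieces; the cases [y = [::]] reconcile these. *)
Lemma mem_Psi w : (w \in Psi t u (u ++ r)) = (swap r u w \in t).
Proof.
have [t0 _ _] := tt.
rewrite /Psi mem_graft mem_subtree mem_prune prefix_cat2l.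
rewrite drop_size_cat // mem_graft mem_prune mem_subtree.
rewrite eqseq_cat // eqxx /=.
case: (swapP r u w) => [y|y uy|{}w rw].
- rewrite !prefix_prefix cat_eq_self !drop_size_cat // prefix_prefix cat_eq_self.
  rewrite -catA.
  have /negbTE -> : u ++ y != [::] by case: u u0.
  rewrite andbF /=; have [->|y0] := eqVneq y [::]; last by rewrite andbF.
  by rewrite !cats0 vt orbT.
- rewrite prefix_prefix cat_eq_self drop_size_cat // uy (negbTE uy) andbT /=.
  rewrite orbF.
  have [->|] := eqVneq y [::]; first by rewrite cats0 vt t0.
  by rewrite andbF.
- by rewrite (negbTE rw) andbT orbF.
Qed.

Lemma Psi_imfset : Psi t u (u ++ r) = [fset swap u r x | x in t].
Proof.
apply/fsetP => w; rewrite mem_Psi; apply/idP/imfsetP => /= [wt|[x xt ->]].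
  by exists (swap r u w) => //; rewrite swapK.
by rewrite swapK.
Qed.

(** Appending a letter commutes with the relabelling except at the cut points: where the child was
    [u ++ r], the old root now stands, and where it was [u], now [u ++ r] stands. All of these are
    vertices, so no child is gained or lost. *)
Lemma swap_rcons x j : x \in t ->
  (swap r u (rcons (swap u r x) j) \in t) = (rcons x j \in t).
Proof.
have [t0 _ _] := tt.
have ut := plane_tree_prefix tt vt.
case: (swapP u r x) => [y _|y ry _|{}x ux _].
- by rewrite !rcons_cat swap_desc.
- have [/prefixP[z]|ryj] := boolP (prefix r (rcons y j)); last first.
    by rewrite swap_out // rcons_cat.
  case/lastP: z => [|z k].
    rewrite cats0 => yj; rewrite yj -[X in swap _ _ X]cats0 swap_mid ?t0.
      by rewrite rcons_cat yj vt.
    by case: u u0.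
  by rewrite -rcons_cat => /rcons_inj[yE _]; rewrite yE prefix_prefix in ry.
- rewrite rcons_cat; have [/prefixP[z]|uxj] := boolP (prefix u (rcons x j)).
    case/lastP: z => [|z k].
      move=> xj; rewrite xj cats0 -[X in swap _ _ (_ ++ X)]cats0 swap_desc.
      by rewrite cats0 ut vt.
    by rewrite -rcons_cat => /rcons_inj[xE _]; rewrite xE prefix_prefix in ux.
  by rewrite swap_mid.
Qed.

Lemma nchild_Psi x : x \in t ->
  nchild (Psi t u (u ++ r)) (swap u r x) = nchild t x.
Proof.
move=> xt; apply: nchild_unique => j; rewrite mem_Psi swap_rcons //.
exact: (@nchildP (PlaneTree (asboolT tt))).
Qed.

(** Serves two counts: the vertices with a given number of children, and the vertices preceding the
    marked one. *)
Lemma card_Psi (p q : pred word) :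
  (forall x, x \in t -> q (swap u r x) = p x) ->
  #|` [fset w in Psi t u (u ++ r) | q w]| = #|` [fset w in t | p w]|.
Proof.
move=> qp; rewrite Psi_imfset.
rewrite -[RHS](card_imfset imfset_key (mem [fset w in t | p w])
  (can_inj (@swapK u r))) /=.
congr #|` _|; apply/fsetP => w; rewrite !inE /=.
apply/andP/imfsetP => /= [[/imfsetP[x /= xt ->] qx]|[x]].
  by exists x => //; rewrite !inE xt -qp.
rewrite !inE => /andP[xt px] ->; rewrite qp //; split=> //.
by apply/imfsetP; exists x.
Qed.
End Psi.

(** * Depth-first labels *)

Lemma mem_dfs (t : {fset word}) : Defs.dfs t =i t.
Proof. by move=> w; rewrite mem_sort. Qed.

Lemma uniq_dfs (t : {fset word}) : uniq (Defs.dfs t).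
Proof. by rewrite sort_uniq; exact: fset_uniq. Qed.

Lemma index_sorted_lt disp (T : orderType disp) (s : seq T) x :
  sorted (fun y z => y < z)%O s -> x \in s ->
  index x s = count (fun y => y < x)%O s.
Proof.
elim: s => //= y s IH ys; rewrite inE eq_sym.
have [->|yx] := eqVneq x y.
  rewrite ltxx /= => _; apply/esym/eqP; rewrite -leqn0 leqNgt -has_count.
  apply/hasPn => z zs.
  have /allP/(_ z zs) yz := order_path_min lt_trans ys.
  by rewrite -leNgt ltW.
move=> /= xs; rewrite IH ?(path_sorted ys) //.
have /allP/(_ x xs) -> := order_path_min lt_trans ys.
by rewrite add1n.
Qed.

(** Turns a label into a cardinal, which [card_Psi] can carry over to the transformed tree. *)
Lemma index_dfs (t : {fset word}) w : w \in t ->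
  index w (Defs.dfs t) = #|` [fset x in t | lexlt x w]|.
Proof.
move=> wt; have dt : sorted (fun y z => (y : seqlexi nat) < z)%O (Defs.dfs t).
  by rewrite (@sort_lt_sorted _ (seqlexi nat)); exact: fset_uniq.
rewrite (@index_sorted_lt _ (seqlexi nat)) ?mem_dfs //.
rewrite -size_filter; apply/perm_size/uniq_perm;
  rewrite ?filter_uniq ?uniq_dfs //.
  exact: fset_uniq.
by move=> x; rewrite mem_filter mem_dfs !inE andbC.
Qed.

Lemma vertex_Psi (t : {fset word}) u r k :
  is_plane_tree t -> u != [::] -> vertex t k = u ++ r ->
  vertex (Psi t u (u ++ r)) k = r ++ u.
Proof.
move=> tt u0 vE.
(* Out of range, [vertex] would be the default [[::]], whereas [u ++ r] is nonempty. *)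
have kt : k.-1 < size (Defs.dfs t).
  rewrite ltnNge; apply/negP => /(nth_default [::]).
  by rewrite -/(vertex t k) vE; case: u u0 {vE}.
have vt : u ++ r \in t by rewrite -vE -mem_dfs mem_nth.
have v't : r ++ u \in Psi t u (u ++ r).
  by rewrite mem_Psi // -[u in X in swap _ _ X]cats0 swap_desc cats0.
rewrite /vertex.
have <- : index (r ++ u) (Defs.dfs (Psi t u (u ++ r))) = k.-1.
  rewrite -(index_uniq [::] kt (uniq_dfs t)) -/(vertex t k) vE !index_dfs //.
  by apply: (card_Psi tt vt u0) => x _; rewrite lexlt_swap.
by apply: nth_index; rewrite mem_dfs.
Qed.

(** * The transformation at a fixed label *)

(** For positive [h] the default of [insubd] is never reached, by [vertices_shuffle]. A label out of
    range designates the root and leaves [t] unchanged, so every [k] is allowed. *)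
Definition shuffle (h k : nat) (t : plane_tree) : plane_tree :=
  let v := vertex t k in
  if h < size v then insubd t (Psi t (take (size v - h) v) v) else t.

Variant shuffle_spec (h k : nat) (t : plane_tree) : plane_tree -> Prop :=
| ShuffleLow of size (vertex t k) <= h : shuffle_spec h k t t
| ShuffleHigh (u r : word) t' of h < size (vertex t k) & vertex t k = u ++ r
    & size r = h & u != [::] & u ++ r \in vertices t
    & vertices t' = Psi t u (u ++ r) : shuffle_spec h k t t'.

Lemma mem_vertex (t : plane_tree) k : vertex t k \in vertices t.
Proof.
have [t0 _ _] := plane_treeP t; rewrite /vertex.
case: (ltnP k.-1 (size (Defs.dfs t))) => [/(mem_nth [::])|kt].
  by rewrite mem_dfs.
by rewrite nth_default.
Qed.

Lemma vertices_shuffle h k t : 0 < h -> vertices (shuffle h k t) =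
  let v := vertex t k in
  if h < size v then Psi t (take (size v - h) v) v else t.
Proof.
move=> h0; rewrite /shuffle /=; case: ltnP => // hv.
rewrite insubdK //; apply/asboolP.
have tt := plane_treeP t; have vt := mem_vertex t k.
apply: Psi_plane_tree => //; last 2 first.
- exact: prefix_take.
- apply/eqP => /(congr1 size)/eqP; rewrite size_takel ?leq_subr // ltn_eqF //.
  by rewrite ltn_subrL h0 (leq_ltn_trans _ hv).
apply: (@plane_tree_prefix _ _ (drop (size (vertex t k) - h) (vertex t k)));
  first exact: tt.
by rewrite cat_take_drop.
Qed.

Lemma shuffleP h k t : 0 < h -> shuffle_spec h k t (shuffle h k t).
Proof.
move=> h0; have := vertices_shuffle k t h0.
rewrite /shuffle /=; have [hv|hv] := ltnP; last by constructor.
set v := vertex t k; have vE := cat_take_drop (size v - h) v.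
move=> t'E; apply: (@ShuffleHigh _ _ _ (take (size v - h) v)
  (drop (size v - h) v)); rewrite ?vE //; last exact: mem_vertex.
- by rewrite size_drop subKn // ltnW.
- by rewrite -size_eq0 size_takel ?leq_subr // subn_eq0 -ltnNge.
Qed.

Lemma shuffled_walkE h k (t : plane_tree) : 0 < h ->
  shuffled_walk h t k = dfwalk (shuffle h k t).
Proof.
by move=> h0; rewrite vertices_shuffle // /shuffled_walk /=; case: ifP.
Qed.

(** Lets the branch taken be recognised from the image, as injectivity requires. *)
Lemma size_vertex_shuffle h k t : 0 < h ->
  size (vertex (shuffle h k t) k) = size (vertex t k).
Proof.
move=> h0; case: (shuffleP k t h0) => // u r t' hv vE _ u0 vt ->.
by rewrite (vertex_Psi (plane_treeP t)) // vE !size_cat addnC.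
Qed.

Lemma shuffle_inj h k : 0 < h -> injective (shuffle h k).
Proof.
move=> h0 t1 t2 t12.
have := congr1 (fun t : plane_tree => size (vertex t k)) t12.
rewrite !size_vertex_shuffle //.
move: t12; case: (shuffleP k t1 h0) => [h1|u1 r1 t1' h1 v1 s1 u10 vt1 t1E].
  by case: (shuffleP k t2 h0) => // *; lia.
case: (shuffleP k t2 h0) => [|u2 r2 t2' h2 v2 s2 u20 vt2 t2E t12 _].
  by lia.
have := congr1 (fun t : plane_tree => vertex t k) t12.
rewrite t1E t2E !(vertex_Psi (plane_treeP _)) // => /eqP.
(* Both [r1] and [r2] have length [h], so the two equal words split in the same way. *)
rewrite eqseq_cat ?s1 ?s2 // => /andP[/eqP r12 /eqP u12].
apply/val_inj/fsetP => w /=.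
(* Once [u] and [r] are known, membership in the original tree is read off from the image. *)
rewrite -[w](swapK u1 r1) -(mem_Psi (plane_treeP t1)) // -t1E t12 t2E.
by rewrite mem_Psi ?r12 ?u12 //; exact: plane_treeP.
Qed.

Lemma shuffle_trees_with h k N t : 0 < h ->
  trees_with N t -> trees_with N (shuffle h k t).
Proof.
move=> h0; case: (shuffleP k t h0) => // u r t' _ _ _ u0 vt t'E tN i.
rewrite -tN t'E; apply: (card_Psi (plane_treeP t)) => // x xt.
by rewrite nchild_Psi //; exact: plane_treeP.
Qed.

(* Invariance of the uniform law and conditioning on the label *)
Local Close Scope fset_scope.

(** An injective self-map of a finite set is onto, so [g] maps the part of [E] over [A] bijectively
    onto the part of [E] in [A]. *)
Lemma uniform_on_preimage (R : realType) (T : choiceType) (E A : set T)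
    (g : T -> T) :
  finite_set E -> (forall x, E x -> E (g x)) -> injective g ->
  uniform_on R E (g @^-1` A) = uniform_on R E A.
Proof.
move=> Efin gE ginj; rewrite /uniform_on.
have gEE : g @` E = E.
  apply: fset_set_inj => //; first exact: finite_image.
  apply/eqP; rewrite eqEfcard; apply/andP; split; last first.
    by rewrite fset_set_image // card_imfset.
  rewrite -fset_set_sub //; last exact: finite_image.
  by move=> _ [x Ex <-]; exact: gE.
suff -> : E `&` A = g @` (E `&` g @^-1` A).
  rewrite fset_set_image ?card_imfset //; exact: finite_setIl.
apply/seteqP; split=> [y []|_ [x [Ex Ax] <-]]; last by split=> //; exact: gE.
by rewrite -{1}gEE => -[x Ex <-] Ax; exists x.
Qed.

(* On an infinite set [fset_set] is empty, so [uniform_on] is the null measure. *)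
Lemma finite_trees_with (R : realType) N :
  uniform_on R (trees_with N) setT = 1%E -> finite_set (trees_with N).
Proof.
move=> E1; apply/not_notP => Einf; move: E1; rewrite /uniform_on setIT.
rewrite /fset_set; case: pselect => // _.
by rewrite cardfs0 GRing.mul0r => -[] /esym/eqP; rewrite GRing.oner_eq0.
Qed.

Theorem proposition4 (R : realType) (d : measure_display)
    (Omega : measurableType d) (P : probability Omega R)
    (N : nat -> nat) (hN : degree_sequence N) (hs : (2 <= degree_size N)%N)
    (Theta : {RV P >-> plane_tree}) (V : {RV P >-> nat})
    (law_Theta : forall A : set plane_tree,
       distribution P Theta A = uniform_on R (trees_with N) A)
    (law_V : forall B : set nat,
       distribution P V B
       = uniform_on R [set k | (2 <= k <= degree_size N)%N] B)
    (indep : independent2 Theta V)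
    (h : nat) (hpos : (0 < h)%N) :
  let W := fun omega => dfwalk (Theta omega) in
  let W' := fun omega => shuffled_walk h (Theta omega) (V omega) in
  forall A : set (seq int * nat),
    P [set omega | A (W' omega, V omega)]
    = P [set omega | A (W omega, V omega)].
Proof.
move=> W W' A.
have Nfin : finite_set (trees_with N).
  by apply: (@finite_trees_with R); rewrite -law_Theta probability_setT.
(* Splitting over the value of [V], for a general [f] so as to apply to both walks; the weights do
   not depend on [f]. *)
have sumE (f : plane_tree -> nat -> seq int) :
    P [set omega | A (f (Theta omega) (V omega), V omega)] =
    (\sum_(k <oo) uniform_on R (trees_with N) [set t | A (f t k, k)]
                  * P (V @^-1` [set k]))%E.
  rewrite (_ : [set omega | _] = \bigcup_k
      (Theta @^-1` [set t | A (f t k, k)] `&` V @^-1` [set k])); last first.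
    apply/seteqP; split=> [w Aw|w [k _ [/= Aw Vw]]]; first by exists (V w).
    by rewrite /= Vw.
  (* Every set of trees is measurable, the sigma-algebra being discrete. *)
  have mVT k (B : set plane_tree) :
      measurable (Theta @^-1` B `&` V @^-1` [set k]).
    apply: measurableI; rewrite -[X in measurable X]setTI;
      exact: measurable_funPT.
  rewrite measure_bigcup //; last first.
    by move=> i j _ _ [w [[_ /= <-] [_ /= <-]]].
  rewrite (eq_eseriesl (Q := predT)) => [|k]; last by rewrite in_setT.
  by apply: eq_eseriesr => k _; rewrite -law_Theta; exact: indep.
rewrite (sumE (fun t _ => dfwalk t)) (sumE (fun t k => shuffled_walk h t k)).
apply: eq_eseriesr => k _; congr (_ * _)%E.
rewrite -[RHS](@uniform_on_preimage _ _ _ _ (shuffle h k)) //.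
- congr uniform_on; apply/seteqP; split=> t /=;
    by rewrite shuffled_walkE.
- by move=> t; exact: shuffle_trees_with.
- exact: shuffle_inj.
Qed.
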